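(* The quantities $\overline{\mathsf{sw}}(T^\dagger)$ and $\overline{\mathsf{cs}}(T^\dagger)$ induced by the optimal linear tariff $T^\dagger$, as a tariff parametrized by $F$, are decreasing and concave in $F\in[\overline{\phi}(\pi^* ),\overline{\phi}(\pi^{\mathrm{M}})]$, with $\overline{\mathsf{sw}}(T^\dagger)=\overline{\mathsf{sw}}^*$ and $\overline{\mathsf{cs}}(T^\dagger)=\overline{\mathsf{sw}}^*-F$ for $F=\overline{\phi}(\pi^* )$.
   Context: Model. Fix integers $N,M\ge 1$. $\lambda$ is a random vector in $\mathbb{R}_+^N$ (wholesale prices) and, for $i=1,\dots,M$, $\omega^i=(\omega^i_1,\dots,\omega^i_N)$ is a random vector in $\mathbb{R}^N$ (local state of customer $i$); $\omega=(\omega^1,\dots,\omega^M)$; the joint law of $(\lambda,\omega)$ is arbitrary. An overline denotes expectation, e.g. $\overline{\lambda}=\mathbb{E}[\lambda]$. Customer $i$ has a gross surplus function $S^i:\mathbb{R}^N\times\mathbb{R}^N\to\mathbb{R}$, $(q^i,\omega^i)\mapsto S^i(q^i,\omega^i)$, continuously differentiable. A (ex-ante) tariff is a deterministic function $T:\mathbb{R}^N\to\mathbb{R}$. A causal policy is a map $\omega^i\mapsto q^i(\omega^i)\in\mathbb{R}^N$ whose $k$-th component depends only on $(\omega^i_1,\dots,\omega^i_k)$. Given $T$, customer $i$'s consumption $q^i(T,\omega^i)$ is a causal policy maximizing $\mathbb{E}[S^i(q^i(\omega^i),\omega^i)-T(q^i(\omega^i))]$. (Every customer pays the charge $T$; no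 customer opts out.) Define the expected consumer, retailer and total surplus $$\overline{\mathsf{cs}}(T)=\mathbb{E}\Big[\sum_{i=1}^M S^i(q^i(T,\omega^i),\omega^i)-T(q^i(T,\omega^i))\Big],\quad \overline{\mathsf{rs}}(T)=\mathbb{E}\Big[\sum_{i=1}^M T(q^i(T,\omega^i))-\lambda^\top q^i(T,\omega^i)\Big],$$ $\overline{\mathsf{sw}}(T)=\overline{\mathsf{cs}}(T)+\overline{\mathsf{rs}}(T)$. Demand. For affine tariffs $T(q)=A+\pi^\top q$ it is assumed that $q^i(T,\omega^i)$ depends on $T$ only through $\pi$, and one writes $D^i(\pi,\omega^i)=q^i(T,\omega^i)$. It is assumed that $D^i$ is componentwise nonnegative, continuously differentiable in $\pi$, and that $\nabla_\pi D^i$ is negative definite ($x^\top(\nabla_\pi D^i)x<0$ for all $x\ne0$; symmetry is not required). $D(\pi,\omega)=\sum_{i=1}^M D^i(\pi,\omega^i)$. Convention: in products with vectors, the $N\times N$ matrix $\nabla_\pi D$ has $(k,t)$ entry $\partial D_t/\partial\pi_k$. All expectations are assumed finite and differentiation may be exchanged with expectation. Define $\overline{\phi}(\pi)=\mathbb{E}[(\pi-\lambda)^\top D(\pi,\omega)]$, so that $\overline{\mathsf{rs}}(T)=\overline{\phi}(\pi)$ for the linear tariff $T(q)=\pi^\top q$. Standing assumption (Assumption 1): $g(\pi)=\mathbb{E}[\nabla_\pi D(\pi,\omega)(\pi-\lambda)]$ has a negative definite Jacobian matrix $\nabla g(\pi)$ for all $\pi$. Optimal two-part tariff for target $F$: $T^*(q)=A^*+\pi^{*\top}q$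 is the maximizer of $\overline{\mathsf{cs}}(T)$ subject to $\overline{\mathsf{rs}}(T)=F$ over all $T(q)=A+\pi^\top q$ with $A\in\mathbb{R},\pi\in\mathbb{R}^N$; its price satisfies $\pi^*=\overline{\lambda}+\mathbb{E}[\nabla_\pi D(\pi^*,\omega)]^{-1}\mathbb{E}[\nabla_\pi D(\pi^*,\omega)(\lambda-\overline{\lambda})]$, and $\overline{\mathsf{sw}}^*=\overline{\mathsf{sw}}(T^* )$; both $\pi^*$ and $\overline{\mathsf{sw}}^*$ do not depend on $F$. Optimal linear tariff for target $F$: $T^\dagger(q)=\pi^{\dagger\top}q$ is the maximizer of $\overline{\mathsf{cs}}(T)$ subject to $\overline{\mathsf{rs}}(T)=F$ over all $T(q)=\pi^\top q$, $\pi\in\mathbb{R}^N$. $\pi^{\mathrm{M}}$ is the price that maximizes $\overline{\mathsf{rs}}(T)=\overline{\phi}(\pi)$ over $\pi$. *)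

(* Defs.v *)
(* MathComp / MathComp-Analysis. *)
From HB Require Import structures.
From mathcomp Require Import all_boot all_order all_algebra.
From mathcomp Require Import all_classical all_reals all_analysis.
Import Order.TTheory GRing.Theory Num.Theory.
Import numFieldNormedType.Exports.

Set Implicit Arguments.
Unset Strict Implicit.
Unset Printing Implicit Defensive.

Local Open Scope classical_set_scope.
Local Open Scope ring_scope.

(* Vectors of R^N are row vectors. *)

Definition dot (R : realType) (N : nat) (u v : 'rV[R]_N) : R :=
  (u *m v^T) 0 0.

(* The matrix need not be symmetric. *)
Definition negative_definite (R : realType) (N : nat) (A : 'M[R]_N) : Prop :=
  forall v : 'rV[R]_N, v != 0 -> dot (v *m A) v < 0.

(* Directionwise continuity of the differential is the usual notion of
   continuous differentiability only in finite dimension, where it is used. *)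
Definition continuously_differentiable (R : realType)
    (U V : normedModType R) (f : U -> V) : Prop :=
  (forall x, differentiable f x) /\
  (forall v, continuous (fun x => 'd f x v)).

Definition concave_on (R : realType) (D : set R) (f : R -> R) : Prop :=
  convex_function (E := R^o) D (fun x => - f x).

Definition strictly_decreasing_on (R : realType) (D : set R) (f : R -> R)
    : Prop :=
  forall x y, D x -> D y -> x < y -> f y < f x.

(* Borel measurability of a map R^N -> R^N, checked on coordinates. *)
Definition borel_map (R : realType) (N : nat) (q : 'rV[R]_N -> 'rV[R]_N)
    : Prop :=
  forall k : 'I_N, measurable_fun [set: g_sigma_algebraType (@open 'rV[R]_N)]
    (fun w : g_sigma_algebraType (@open 'rV[R]_N) => q w 0 k).

Definition causal (R : realType) (N : nat) (q : 'rV[R]_N -> 'rV[R]_N)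
    : Prop :=
  forall (k : 'I_N) (w w' : 'rV[R]_N),
    (forall j : 'I_N, (j <= k)%N -> w 0 j = w' 0 j) -> q w 0 k = q w' 0 k.

Definition tariff (R : realType) (N : nat) := 'rV[R]_N -> R.

Definition two_part_tariff (R : realType) (N : nat) (A : R) (p : 'rV[R]_N)
    : tariff R N :=
  fun q => A + dot p q.

Definition linear_tariff (R : realType) (N : nat) (p : 'rV[R]_N)
    : tariff R N :=
  two_part_tariff 0 p.

Definition two_part_tariffs (R : realType) (N : nat) : set (tariff R N) :=
  [set T | exists A p, T = two_part_tariff A p].

Definition linear_tariffs (R : realType) (N : nat) : set (tariff R N) :=
  [set T | exists p, T = linear_tariff p].

(* Data only; [consumption T i] is the policy q^i(T, .) used by customer i
   facing the tariff T. *)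
Record market (d : measure_display) (Omega : measurableType d) (R : realType)
    (N M : nat) := Market {
  wholesale : Omega -> 'rV[R]_N;
  state : 'I_M -> Omega -> 'rV[R]_N;
  surplus : 'I_M -> 'rV[R]_N -> 'rV[R]_N -> R;
  consumption : tariff R N -> 'I_M -> 'rV[R]_N -> 'rV[R]_N }.

Section Market.
Context {d : measure_display} {Omega : measurableType d} {R : realType}.
Context (P : probability Omega R) {N M : nat} (mk : market Omega R N M).

(* [fine] is harmless under the integrability assumptions below. *)
Definition mean (X : Omega -> R) : R := fine ('E_P[X])%E.

Definition finite_mean (X : Omega -> R) : Prop :=
  P.-integrable [set: Omega] (EFin \o X).

Definition random_vector (X : Omega -> 'rV[R]_N) : Prop :=
  forall k : 'I_N, measurable_fun [set: Omega] (fun x => X x 0 k).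

Definition payoff (i : 'I_M) (T : tariff R N) (q : 'rV[R]_N -> 'rV[R]_N)
    (x : Omega) : R :=
  surplus mk i (q (state mk i x)) (state mk i x) - T (q (state mk i x)).

Definition admissible_policy (i : 'I_M) (T : tariff R N)
    (q : 'rV[R]_N -> 'rV[R]_N) : Prop :=
  [/\ causal q, borel_map q & finite_mean (payoff i T q)].

Definition optimal_policy (i : 'I_M) (T : tariff R N)
    (q : 'rV[R]_N -> 'rV[R]_N) : Prop :=
  admissible_policy i T q /\
  forall q', admissible_policy i T q' ->
    mean (payoff i T q') <= mean (payoff i T q).

Definition consumer_surplus (T : tariff R N) : R :=
  mean (fun x => \sum_(i < M) payoff i T (consumption mk T i) x).

Definition retailer_surplus (T : tariff R N) : R :=
  mean (fun x => \sum_(i < M)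
    (T (consumption mk T i (state mk i x)) -
     dot (wholesale mk x) (consumption mk T i (state mk i x)))).

Definition total_surplus (T : tariff R N) : R :=
  consumer_surplus T + retailer_surplus T.

Definition demand (i : 'I_M) (p w : 'rV[R]_N) : 'rV[R]_N :=
  consumption mk (linear_tariff p) i w.

Definition total_demand (p : 'rV[R]_N) (x : Omega) : 'rV[R]_N :=
  \sum_(i < M) demand i p (state mk i x).

(* 'J acts on row vectors on the right: the (k, t) entry of ['J f p] is the
   partial derivative of the t-th component of f in the k-th variable. *)
Definition grad_total_demand (p : 'rV[R]_N) (x : Omega) : 'M[R]_N :=
  'J (fun p' => total_demand p' x) p.

(* The transpose comes from writing (grad D) u for a row vector u. *)
Definition markup_response (p u : 'rV[R]_N) (x : Omega) : 'rV[R]_N :=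
  u *m (grad_total_demand p x)^T.

Definition linear_revenue (p : 'rV[R]_N) (x : Omega) : R :=
  dot (p - wholesale mk x) (total_demand p x).

Definition phi (p : 'rV[R]_N) : R := mean (linear_revenue p).

Definition g (p : 'rV[R]_N) : 'rV[R]_N :=
  \row_k mean (fun x => markup_response p (p - wholesale mk x) x 0 k).

Definition optimal_tariff (C : set (tariff R N)) (F : R) (T : tariff R N)
    : Prop :=
  [/\ C T, retailer_surplus T = F &
      forall T', C T' -> retailer_surplus T' = F ->
        consumer_surplus T' <= consumer_surplus T].

Definition exchangeable (f : 'rV[R]_N -> Omega -> R) : Prop :=
  forall p : 'rV[R]_N,
    differentiable ((fun p' => mean (f p')) : 'rV[R]_N -> R^o) p /\
    forall v : 'rV[R]_N,
      'd ((fun p' => mean (f p')) : 'rV[R]_N -> R^o) p v =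
      mean (fun x => 'd ((fun p' => f p' x) : 'rV[R]_N -> R^o) p v).

Record primitives_ok : Prop := PrimitivesOk {
  wholesale_rv : random_vector (wholesale mk);
  wholesale_ge0 : forall x k, 0 <= wholesale mk x 0 k;
  state_rv : forall i, random_vector (state mk i);
  surplus_C1 : forall i, continuously_differentiable
    ((fun z => surplus mk i z.1 z.2) : 'rV[R]_N * 'rV[R]_N -> R^o) }.

(* Nonnegativity of demand is stated separately, in [demand_ge0_at]. *)
Record demand_ok : Prop := DemandOk {
  consumption_optimal : forall A p i,
    optimal_policy i (two_part_tariff A p)
      (consumption mk (two_part_tariff A p) i);
  consumption_price_only : forall A p i w,
    consumption mk (two_part_tariff A p) i w = demand i p w;
  demand_C1 : forall i w, continuously_differentiable (fun p => demand i p w);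
  demand_grad_nd : forall i p w,
    negative_definite ('J (fun p' => demand i p' w) p) }.

(* Nonnegative demand at every price vector of R^N is too much to ask when
   policies may take arbitrary values in R^N.  Already for a deterministic
   state, the optimal payoff V(p) = sup_q (S(q) - p^T q) has gradient - D(p),
   so it would be nonincreasing in p, whereas V(p) >= S(q) - p^T q is unbounded
   as p grows when q < 0.  Nonnegativity is therefore only ever required at
   given prices. *)
Definition demand_ge0_at (p : 'rV[R]_N) : Prop :=
  forall i w k, 0 <= demand i p w 0 k.

Record expectations_ok : Prop := ExpectationsOk {
  wholesale_mean : forall k, finite_mean (fun x => wholesale mk x 0 k);
  surplus_mean : forall i p,
    finite_mean (fun x =>
      surplus mk i (demand i p (state mk i x)) (state mk i x));
  demand_mean : forall i p k,
    finite_mean (fun x => demand i p (state mk i x) 0 k);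
  wholesale_cost_mean : forall p,
    finite_mean (fun x => dot (wholesale mk x) (total_demand p x));
  grad_demand_mean : forall p k t,
    finite_mean (fun x => grad_total_demand p x k t);
  grad_cost_mean : forall p k,
    finite_mean (fun x => markup_response p (wholesale mk x) x 0 k);
  demand_exchange : forall k, exchangeable (fun p x => total_demand p x 0 k);
  revenue_exchange : exchangeable linear_revenue }.

Definition assumption1 : Prop :=
  forall p, differentiable g p /\ negative_definite ('J g p).

End Market.

(* Main.v *)
(* Let V, W = V + phi be the consumer and the total surplus of the linear tariff
   with price p.  Since the policy chosen at p stays available at any other price,
   V is convex with gradient - E[D]; as phi has gradient E[D] + g, W has gradient
   g, which is strictly monotone by Assumption 1.  So W is strictly concave,
   phi = W - V is concave, and pistar is the only maximizer of W.  On the level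
   set phi = F, maximizing V is maximizing W, and on the way from any point of
   {phi >= F} to pistar one meets this level set without decreasing W.  Hence
   swdag(F) is the maximum of W over {phi >= F}: a concave program whose value
   is concave and, as long as pistar is infeasible, strictly decreasing in F. *)

Require Import Defs.
From HB Require Import structures.
From mathcomp Require Import all_boot all_order all_algebra.
From mathcomp Require Import all_classical all_reals all_analysis.
From mathcomp Require Import ring lra.
Import Order.TTheory GRing.Theory Num.Theory.
Import numFieldNormedType.Exports.

Local Open Scope classical_set_scope.
Local Open Scope ring_scope.

(** * Bilinearity of the dot product *)

Section DotProduct.
Context {R : realType} {N : nat}.
Implicit Types u v w : 'rV[R]_N.

Lemma dotE u v : dot u v = \sum_k u 0 k * v 0 k.
Proof. by rewrite /dot mxE; apply: eq_bigr => k _; rewrite mxE. Qed.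

Lemma dotC u v : dot u v = dot v u.
Proof. by rewrite !dotE; apply: eq_bigr => k _; rewrite mulrC. Qed.

Lemma dotDl u v w : dot (u + v) w = dot u w + dot v w.
Proof. by rewrite /dot mulmxDl mxE. Qed.

Lemma dotBl u v w : dot (u - v) w = dot u w - dot v w.
Proof. by rewrite /dot mulmxBl !mxE. Qed.

Lemma dotZl a u v : dot (a *: u) v = a * dot u v.
Proof. by rewrite /dot -scalemxAl mxE. Qed.

Lemma dotDr u v w : dot u (v + w) = dot u v + dot u w.
Proof. by rewrite dotC dotDl !(dotC u). Qed.

Lemma dotNr u v : dot u (- v) = - dot u v.
Proof. by rewrite dotC -scaleN1r dotZl mulN1r dotC. Qed.

Lemma dot_sumr (I : finType) u (F : I -> 'rV[R]_N) :
  dot u (\sum_i F i) = \sum_i dot u (F i).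
Proof.
by rewrite /dot linear_sum mulmx_sumr summxE.
Qed.

Lemma dot_mulmx u v (A : 'M[R]_N) : dot u (v *m A) = dot v (u *m A^T).
Proof. by rewrite dotC /dot trmx_mul trmxK mulmxA. Qed.

End DotProduct.

(** * Directional derivatives and one-variable tangent inequalities *)

Section Differentiation.
Context {R : realType}.

(** Both sides have the same difference quotient; this reduces gradient arguments to functions of
    one real variable. *)
Lemma is_derive_line (V : normedModType R) (f : V -> R) (a v : V) (t df : R) :
  is_derive t 1 (fun s => f (a + s *: v)) df <->
  is_derive (a + t *: v) v (f : V -> R^o) df.
Proof.
have E : (fun h : R => h^-1 *: (((fun s => f (a + s *: v)) \o shift t) (h *: 1)
            - f (a + t *: v))) =
         (fun h => h^-1 *: (((f : V -> R^o) \o shift (a + t *: v)) (h *: v)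
            - f (a + t *: v))).
  apply/funext => h /=; congr (_ *: (f _ - _)).
  by rewrite [h *: 1]mulr1 scalerDl addrCA.
split=> -[dfa fa]; apply: DeriveDef.
- by move: dfa; rewrite /derivable E.
- by move: fa; rewrite /derive E.
- by move: dfa; rewrite /derivable -E.
- by move: fa; rewrite /derive -E.
Qed.

Lemma is_derive_dot (V : normedModType R) N (a b : V -> 'rV[R]_N) (x v : V)
    (da db : 'rV[R]_N) :
  is_derive x v a da -> is_derive x v b db ->
  is_derive x v (fun y => dot (a y) (b y) : R^o) (dot (a x) db + dot (b x) da).
Proof.
move=> [dax <-] [dbx <-].
have -> : (fun y => dot (a y) (b y) : R^o) =
    \sum_k ((fun y => a y 0 k : R^o) * (fun y => b y 0 k : R^o)).
  by apply/funext => y; rewrite dotE fct_sumE.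
rewrite (derive_mx dax) (derive_mx dbx) !dotE -big_split /=.
apply: is_derive_sum => k; rewrite !mxE.
move/derivable_mxP : dax => /(_ 0 k) /derivableP da1.
move/derivable_mxP : dbx => /(_ 0 k) /derivableP db1.
exact: is_deriveM.
Qed.

Lemma differentiable_dot (V : normedModType R) N (a b : V -> 'rV[R]_N) (x : V) :
  differentiable a x -> differentiable b x ->
  differentiable (fun y => dot (a y) (b y) : R^o) x.
Proof.
move=> da db.
have -> : (fun y => dot (a y) (b y) : R^o) =
    \sum_k ((fun y => a y 0 k : R^o) * (fun y => b y 0 k : R^o)).
  by apply/funext => y; rewrite dotE fct_sumE.
have dk (c : V -> 'rV[R]_N) k : differentiable c x ->
    differentiable (fun y => c y 0 k : R^o) x.
  move=> dc; apply: (@differentiable_comp _ _ _ R^o c (fun M => M 0 k)) => //.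
  exact: differentiable_coord.
by apply: differentiable_sum => k; apply: differentiableM; exact: dk.
Qed.

(** The subgradient inequalities at [x] and at [z] squeeze the slope of the chord from [x] to [z]
    between [s x] and [s z]. So the chord slope, completed by [s x] at [x], is continuous there,
    which is Carathéodory's criterion. *)
Lemma subgradient_is_derive (f s : R -> R) (x : R) :
  (forall y z, f y + s y * (z - y) <= f z) -> {for x, continuous s} ->
  is_derive x 1 f (s x).
Proof.
move=> fs cs; apply/is_derive1_caratheodory.
exists (fun z => if z == x then s x else (f z - f x) / (z - x)); split.
- move=> z; case: eqP => [->|/eqP zx]; first by rewrite !subrr mulr0.
  by rewrite divfK // subr_eq0.
- apply/cvgrPdist_lt => e e0.
  move/cvgrPdist_lt : cs => /(_ e e0).
  apply: filterS => z sxz; rewrite eqxx; case: eqP => [//|/eqP zx].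
    by rewrite subrr normr0.
  apply: le_lt_trans sxz.
  have zx0 : 0 < `|z - x| by rewrite normr_gt0 subr_eq0.
  rewrite -(ler_pM2r zx0) -!normrM mulrBl divfK ?subr_eq0 //.
  have := fs x z; have := fs z x => h1 h2.
  rewrite ler0_norm; last by lra.
  rewrite -normrN; apply: le_trans (ler_norm _); lra.
- by rewrite eqxx.
Qed.

(** By the mean value theorem, [f 1 - f 0] equals [s c] for some [c] strictly between 0 and 1. *)
Lemma strict_tangent (f s : R -> R) :
  (forall t : R, is_derive t 1 f (s t)) -> (forall t, 0 < t -> s t < s 0) ->
  f 1 < f 0 + s 0.
Proof.
move=> fs s0.
have cf : {within `[0, 1], continuous f}.
  apply: continuous_subspaceT => t.
  by apply/differentiable_continuous/derivable1_diffP; exact: ex_derive.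
have [c] := @MVT R f s 0 1 ltr01 (fun t _ => fs t) cf.
rewrite in_itv /= subr0 mulr1 => /andP[c0 _] E.
by have := s0 c c0; rewrite -E; lra.
Qed.

End Differentiation.

(** * Subgradients, strict concavity and maximizers in several variables *)

Section GradientInequalities.
Context {R : realType} {N : nat}.
Implicit Types (f : 'rV[R]_N -> R) (s : 'rV[R]_N -> 'rV[R]_N) (p q v : 'rV[R]_N).

Lemma is_derive_subgradient f s p v :
  (forall p q, f p + dot (q - p) (s p) <= f q) ->
  {for p, continuous (fun q => dot v (s q))} ->
  is_derive p v (f : 'rV[R]_N -> R^o) (dot v (s p)).
Proof.
move=> fs cs; have p0 : p + 0 *: v = p by rewrite scale0r addr0.
rewrite -[X in is_derive X]p0; apply/(is_derive_line _ f p v 0 _).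
rewrite -[X in s X]p0.
apply: (subgradient_is_derive (fun t => f (p + t *: v))
    (fun t => dot v (s (p + t *: v))) 0) => [y z|].
  have := fs (p + y *: v) (p + z *: v).
  by rewrite opprD addrACA subrr add0r -scalerBl dotZl mulrC.
apply: (@continuous_comp _ _ _ (fun t : R => p + t *: v) (fun q => dot v (s q))).
  apply: cvgD; first exact: cvg_cst.
  by apply: cvgZr_tmp; exact: cvg_id.
by rewrite /= scale0r addr0.
Qed.

(** On the segment from [p] to [q], the slope of [f] has as derivative the quadratic form of ['J s]
    at [v], which is negative; the slope therefore stays below its initial value. *)
Lemma strict_tangent_inequality f s p q :
  (forall p v, is_derive p v (f : 'rV[R]_N -> R^o) (dot v (s p))) ->
  (forall p, differentiable s p /\ negative_definite ('J s p)) ->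
  q != p -> f q < f p + dot (q - p) (s p).
Proof.
move=> fs sn qp; set v := q - p.
have v0 : v != 0 by rewrite subr_eq0.
pose l t := p + t *: v.
have ds (t : R) : is_derive t 1 (fun t => dot v (s (l t))) (dot (v *m 'J s (l t)) v).
  apply/(is_derive_line _ (fun p => dot v (s p))).
  have [dst _] := sn (l t).
  have dv : derivable s (l t) v by exact: diff_derivable.
  rewrite -deriveEjacobian //.
  have := is_derive_dot _ _ _ _ _ _ _ _ (is_derive_cst v (l t) v) (derivableP dv).
  have -> : dot (s (l t)) 0 = 0 by rewrite dotC -(scale0r v) dotZl mul0r.
  by rewrite addr0 [X in _ -> is_derive _ _ _ X]dotC.
have -> : q = l 1 by rewrite /l scale1r subrKC.
have -> : p = l 0 by rewrite /l scale0r addr0.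
apply: (strict_tangent (fun t => f (l t)) (fun t => dot v (s (l t)))) => t.
  apply/(is_derive_line _ f p v t _); exact: fs.
move=> t0.
(* A second mean value theorem, now for the slope itself, compares its values at [t] and at 0. *)
have [|c _] := @MVT R (fun t => dot v (s (l t))) (fun t => dot (v *m 'J s (l t)) v) 0 t t0 (fun t _ => ds t).
  apply: continuous_subspaceT => u.
  by apply/differentiable_continuous/derivable1_diffP; exact: ex_derive.
rewrite subr0 => E; rewrite -subr_lt0 E pmulr_llt0 //.
exact: (sn (l c)).2.
Qed.

(** Weight by [t] and [1 - t] the supergradient inequalities at the mixture [z] towards [p] and [q]:
    the linear terms cancel. *)
Lemma supergradient_concave f s p q (t : R) :
  (forall p q, f q <= f p + dot (q - p) (s p)) -> 0 <= t <= 1 ->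
  t * f p + (1 - t) * f q <= f (t *: p + (1 - t) *: q).
Proof.
move=> fs /andP[t0 t1]; set z := t *: p + _.
have pz : p - z = (1 - t) *: (p - q) by apply/rowP => k; rewrite !mxE; ring.
have qz : q - z = (- t) *: (p - q) by apply/rowP => k; rewrite !mxE; ring.
have := fs z p; have := fs z q; rewrite pz qz !dotZl.
move: (f z) (f p) (f q) (dot _ _) => a b c e h1 h2.
have : t * b <= t * (a + (1 - t) * e) by rewrite ler_wpM2l.
have : (1 - t) * c <= (1 - t) * (a + - t * e) by rewrite ler_wpM2l ?subr_ge0.
lra.
Qed.

(** The strict inequalities at the midpoint [m] add up to [f p + f q < 2 * f m], and [f m] is at
    most [f p]. *)
Lemma strict_supergradient_max f s p q :
  (forall p q, q != p -> f q < f p + dot (q - p) (s p)) ->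
  (forall r, f r <= f p) -> q != p -> f q < f p.
Proof.
move=> fs fp qp; set m := 2^-1 *: (p + q).
have pm : p - m = 2^-1 *: (p - q) by apply/rowP => k; rewrite !mxE; field.
have qm : q - m = - (p - m) by apply/rowP => k; rewrite !mxE; field.
have pq0 : p - m != 0 by rewrite pm scaler_eq0 invr_eq0 pnatr_eq0 subr_eq0 /= eq_sym.
have := fs m p; rewrite -subr_eq0 => /(_ pq0) h1.
have := fs m q; rewrite -subr_eq0 qm oppr_eq0 => /(_ pq0).
have -> : dot (- (p - m)) (s m) = - dot (p - m) (s m) by rewrite dotC dotNr dotC.
have := fp m; lra.
Qed.

End GradientInequalities.

(** * The value of a concave program as a function of its constraint level; [f], [w], [a], [sol]
    will be [phi], total surplus, [pistar], [pidag] *)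

Section Frontier.
Context {R : realType} {V : normedModType R} (f w : V -> R) (a : V) (D : set R)
  (sol : R -> V).
Context (f_continuous : continuous f)
  (f_concave : forall p q t, 0 <= t <= 1 ->
     t * f p + (1 - t) * f q <= f (t *: p + (1 - t) *: q))
  (w_concave : forall p q t, 0 <= t <= 1 ->
     t * w p + (1 - t) * w q <= w (t *: p + (1 - t) *: q))
  (w_max : forall p, p != a -> w p < w a)
  (D_ge : forall y, D y -> f a <= y)
  (f_sol : forall y, D y -> f (sol y) = y)
  (w_sol : forall y q, D y -> f q = y -> w q <= w (sol y)).

(* The constraint [f q = y] may be relaxed to [y <= f q]: moving from [q] towards
   the maximizer [a] of [w] increases [w] until [f] drops to the level [y]. *)
Lemma frontier_relax y q : D y -> y <= f q ->
  exists2 t, 0 <= t <= 1 &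
    f (t *: q + (1 - t) *: a) = y /\ t * w q + (1 - t) * w a <= w (sol y).
Proof.
move=> Dy yq; pose h t := f (t *: q + (1 - t) *: a).
have ch : continuous h.
  move=> t; apply: (@continuous_comp _ _ _ (fun t : R => t *: q + (1 - t) *: a) f).
    apply: cvgD; apply: cvgZr_tmp; first exact: cvg_id.
    by apply: cvgB; [exact: cvg_cst|exact: cvg_id].
  exact: f_continuous.
have h0 : h 0 = f a by rewrite /h scale0r add0r subr0 scale1r.
have h1 : h 1 = f q by rewrite /h subrr scale0r addr0 scale1r.
have [| |t] := @IVT R h 0 1 y ler01.
- exact: continuous_subspaceT.
- by rewrite h0 h1 ge_min le_max (D_ge _ Dy) yq orbT.
rewrite in_itv /= => t01 hty; exists t => //; split=> //.
exact: le_trans (w_concave q a t t01) (w_sol y _ Dy hty).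
Qed.

(** By concavity of [f], mixing the solutions at [y] and [z] reaches at least the mixed level, so
    the mixture is feasible for the relaxed constraint; by concavity of [w] it is worth at least the
    mixed value. *)
Lemma frontier_concave y z t : D y -> D z -> 0 <= t <= 1 ->
  D (t * y + (1 - t) * z) ->
  t * w (sol y) + (1 - t) * w (sol z) <= w (sol (t * y + (1 - t) * z)).
Proof.
move=> Dy Dz t01 Dyz.
apply: le_trans (w_concave (sol y) (sol z) t t01) _.
have [|u /andP[u0 u1] [_]] := frontier_relax _ (t *: sol y + (1 - t) *: sol z) Dyz.
  by have := f_concave (sol y) (sol z) t t01; rewrite !f_sol.
apply: le_trans; set q := t *: _ + _.
have wq : w q <= w a by have [->//|/w_max/ltW] := eqVneq q a.
have : 0 <= (1 - u) * (w a - w q) by rewrite mulr_ge0 ?subr_ge0.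
lra.
Qed.

(** The solution at [z] is feasible at the lower level [y] with slack, and using up this slack by a
    move towards [a] strictly raises [w]. *)
Lemma frontier_decreasing y z : D y -> D z -> y < z -> w (sol z) < w (sol y).
Proof.
move=> Dy Dz yz.
have [|u /andP[u0 u1] [fu]] := frontier_relax y (sol z) Dy.
  by rewrite f_sol // ltW.
apply: lt_le_trans.
(* Otherwise [z = f a], which is at most [y]. *)
have za : sol z != a.
  by apply: contraTneq yz => za; rewrite -leNgt -(f_sol _ Dz) za; exact: D_ge.
(* At [u = 1] the point is still [sol z], at level [z] instead of [y]. *)
have u_lt1 : u < 1.
  rewrite lt_neqAle u1 andbT; apply: contraTneq yz => uE.
  by rewrite -fu uE subrr scale0r addr0 scale1r f_sol // ltxx.
have : 0 < (1 - u) * (w a - w (sol z)) by rewrite mulr_gt0 ?subr_gt0 // w_max.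
lra.
Qed.

End Frontier.

(** * Linearity of expectation for integrable real random variables *)

Section Expectation.
Context {d : measure_display} {Omega : measurableType d} {R : realType}.
Context (P : probability Omega R).
Implicit Types X Y : Omega -> R.

Lemma meanE X : mean P X = (\int[P]_x X x)%R.
Proof. by rewrite /mean unlock. Qed.

Lemma mean_cst (a : R) : mean P (cst a) = a.
Proof. by rewrite /mean expectation_cst. Qed.

Lemma finite_mean_cst (a : R) : finite_mean P (cst a).
Proof. exact: finite_measure_integrable_cst. Qed.

Lemma meanD X Y : finite_mean P X -> finite_mean P Y ->
  mean P (fun x => X x + Y x) = mean P X + mean P Y.
Proof. by move=> fX fY; rewrite !meanE RintegralD. Qed.

Lemma meanB X Y : finite_mean P X -> finite_mean P Y ->
  mean P (fun x => X x - Y x) = mean P X - mean P Y.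
Proof. by move=> fX fY; rewrite !meanE RintegralB. Qed.

Lemma meanZ a X : finite_mean P X -> mean P (fun x => a * X x) = a * mean P X.
Proof. by move=> fX; rewrite !meanE RintegralZl. Qed.

Lemma finite_meanB X Y : finite_mean P X -> finite_mean P Y ->
  finite_mean P (fun x => X x - Y x).
Proof. by rewrite /finite_mean => fX fY; exact: (integrableB measurableT fX fY). Qed.

Lemma finite_meanZ a X : finite_mean P X -> finite_mean P (fun x => a * X x).
Proof. by rewrite /finite_mean => fX; exact: (integrableZl measurableT a fX). Qed.

Lemma finite_mean_sum (I : finType) (F : I -> Omega -> R) :
  (forall i, finite_mean P (F i)) -> finite_mean P (fun x => \sum_i F i x).
Proof.
move=> fF; rewrite /finite_mean.
have -> : EFin \o (fun x => \sum_i F i x) = (fun x => \sum_i (F i x)%:E)%E.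
  by apply/funext => x /=; rewrite sumEFin.
by apply: integrable_sum => // i _; exact: fF.
Qed.

Lemma mean_sum (I : finType) (F : I -> Omega -> R) :
  (forall i, finite_mean P (F i)) ->
  mean P (fun x => \sum_i F i x) = \sum_i mean P (F i).
Proof.
move=> fF; rewrite meanE /Rintegral.
under eq_integral do rewrite -sumEFin.
rewrite integral_sum // -sum_fine => [|i _]; last exact: integrable_fin_num (fF i).
by apply: eq_bigr => i _; rewrite meanE.
Qed.

Lemma finite_mean_dot N (u : 'rV[R]_N) (X : Omega -> 'rV[R]_N) :
  (forall k, finite_mean P (fun x => X x 0 k)) ->
  finite_mean P (fun x => dot u (X x)).
Proof.
move=> fX; under eq_fun do rewrite dotE.
by apply: finite_mean_sum => k; exact: finite_meanZ.
Qed.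

Lemma mean_dot N (u : 'rV[R]_N) (X : Omega -> 'rV[R]_N) :
  (forall k, finite_mean P (fun x => X x 0 k)) ->
  mean P (fun x => dot u (X x)) = dot u (\row_k mean P (fun x => X x 0 k)).
Proof.
move=> fX; under eq_fun do rewrite dotE.
rewrite mean_sum => [|k]; last exact: finite_meanZ.
by rewrite dotE; apply: eq_bigr => k _; rewrite meanZ // mxE.
Qed.

End Expectation.

(** * Surpluses of affine tariffs and their gradients in the price *)

Section Market.
Context {d : measure_display} {Omega : measurableType d} {R : realType}.
Context (P : probability Omega R) {N M : nat} (mk : market Omega R N M).
Context (demandP : demand_ok P mk) (expectationsP : expectations_ok P mk).
Implicit Types p q v : 'rV[R]_N.

Local Notation cs p := (consumer_surplus P mk (linear_tariff p)).
Local Notation sw p := (total_surplus P mk (linear_tariff p)).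

Definition mean_demand p : 'rV[R]_N :=
  \row_k mean P (fun x => total_demand mk p x 0 k).

Lemma finite_mean_payoff i p q :
  finite_mean P (payoff mk i (linear_tariff q) (demand mk i p)).
Proof.
apply: finite_meanB; first exact: surplus_mean expectationsP i p.
rewrite /linear_tariff /two_part_tariff; under eq_fun do rewrite add0r.
by apply: finite_mean_dot => k; exact: demand_mean expectationsP i p k.
Qed.

Lemma finite_mean_total_demand p k :
  finite_mean P (fun x => total_demand mk p x 0 k).
Proof.
rewrite /total_demand; under eq_fun do rewrite summxE.
by apply: finite_mean_sum => i; exact: demand_mean expectationsP i p k.
Qed.

(** Demand ignores the fixed charge, which each of the [M] customers pays once. *)
Lemma consumer_surplus_two_part A p :
  consumer_surplus P mk (two_part_tariff A p) = cs p - A *+ M.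
Proof.
rewrite /consumer_surplus -[in RHS](mean_cst P (A *+ M)) -meanB; last 2 first.
- by apply: finite_mean_sum => i; exact: finite_mean_payoff.
- exact: finite_mean_cst.
congr mean; apply/funext => x /=.
have -> : A *+ M = \sum_(i < M) A by rewrite sumr_const card_ord.
rewrite -sumrB.
apply: eq_bigr => i _; rewrite /payoff (consumption_price_only demandP).
by rewrite /linear_tariff /two_part_tariff add0r opprD addrCA addrC.
Qed.

Lemma retailer_surplus_two_part A p :
  retailer_surplus P mk (two_part_tariff A p) = phi P mk p + A *+ M.
Proof.
have fl : finite_mean P (linear_revenue mk p).
  rewrite /linear_revenue; under eq_fun do rewrite dotBl.
  apply: finite_meanB; last exact: wholesale_cost_mean expectationsP p.
  by apply: finite_mean_dot => k; exact: finite_mean_total_demand.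
rewrite /retailer_surplus /phi -[in RHS](mean_cst P (A *+ M)) -meanD //; last first.
  exact: finite_mean_cst.
congr mean; apply/funext => x /=.
have -> : A *+ M = \sum_(i < M) A by rewrite sumr_const card_ord.
rewrite /linear_revenue /total_demand dot_sumr -big_split; apply: eq_bigr => i _ /=.
rewrite (consumption_price_only demandP) dotBl /two_part_tariff.
by ring.
Qed.

Lemma retailer_surplus_linear p :
  retailer_surplus P mk (linear_tariff p) = phi P mk p.
Proof. by rewrite retailer_surplus_two_part mul0rn addr0. Qed.

Lemma total_surplus_linear p : sw p = cs p + phi P mk p.
Proof. by rewrite /total_surplus retailer_surplus_linear. Qed.

(** The fixed charges are a pure transfer from customers to the retailer. *)
Lemma total_surplus_two_part A p :
  total_surplus P mk (two_part_tariff A p) = sw p.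
Proof.
rewrite total_surplus_linear /total_surplus consumer_surplus_two_part.
by rewrite retailer_surplus_two_part addrACA addNr addr0.
Qed.

(* The policy chosen at price [p] stays available at price [q], so optimality
   makes minus the mean demand a subgradient of the consumer surplus. *)
Lemma consumer_surplus_subgradient p q :
  cs p + dot (q - p) (- mean_demand p) <= cs q.
Proof.
have csE r : cs r = \sum_i mean P (payoff mk i (linear_tariff r) (demand mk i r)).
  by rewrite /consumer_surplus mean_sum // => i; exact: finite_mean_payoff.
(* The tangent value at [q] is what customers get if they keep the policies chosen at [p] while
   being billed at [q]. *)
have -> : cs p + dot (q - p) (- mean_demand p) =
    \sum_i mean P (payoff mk i (linear_tariff q) (demand mk i p)).
  rewrite dotNr -mean_dot; last first.
    exact: finite_mean_total_demand.
  rewrite /total_demand; under eq_fun do rewrite dot_sumr.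
  have fd i : finite_mean P (fun x => dot (q - p) (demand mk i p (state mk i x))).
    by apply: finite_mean_dot => k; exact: demand_mean expectationsP i p k.
  rewrite mean_sum // csE -sumrB; apply: eq_bigr => i _.
  rewrite -meanB //; last exact: finite_mean_payoff.
  congr mean; apply/funext => x; rewrite /payoff /linear_tariff /two_part_tariff.
  by rewrite dotBl; ring.
rewrite csE; apply: ler_sum => i _.
(* A linear tariff is a two-part tariff with charge 0. Causality and measurability carry over from
   [p]; only integrability has to be checked at [q]. *)
have [[cp bp _] _] := consumption_optimal demandP 0 p i.
have [_ opt] := consumption_optimal demandP 0 q i.
by apply: opt; split => //; exact: finite_mean_payoff.
Qed.

(** This continuity upgrades the subgradient of the consumer surplus to a gradient. *)
Lemma continuous_mean_demand v : continuous (fun p => dot v (mean_demand p)).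
Proof.
move=> p; apply: (@differentiable_continuous _ _ R^o).
have -> : (fun p => dot v (mean_demand p) : R^o) =
    \sum_k (v 0 k *: (fun p => mean P (fun x => total_demand mk p x 0 k) : R^o)).
  by apply/funext => q; rewrite dotE fct_sumE; apply: eq_bigr => k _; rewrite mxE.
apply: differentiable_sum => k; apply: differentiableZ.
exact: (demand_exchange expectationsP k p).1.
Qed.

(** The product rule is applied to the revenue under the expectation: varying the markup yields mean
    demand, varying demand yields [g]. *)
Lemma is_derive_phi p v :
  is_derive p v (phi P mk : 'rV[R]_N -> R^o) (dot v (mean_demand p + g P mk p)).
Proof.
have [dphi dphiE] := revenue_exchange expectationsP p.
apply: DeriveDef; first exact: diff_derivable.
rewrite deriveE // dphiE.
have dD x : differentiable (fun q => total_demand mk q x) p.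
  have -> : (fun q => total_demand mk q x) =
      \sum_i (fun q => demand mk i q (state mk i x)).
    by apply/funext => q; rewrite fct_sumE.
  by apply: differentiable_sum => i; exact: (demand_C1 demandP i _).1.
(* The response to [p - wholesale] splits into a deterministic combination of demand gradients and
   the wholesale cost term. *)
have fm k : finite_mean P (fun x => markup_response mk p (p - wholesale mk x) x 0 k).
  rewrite /markup_response; under eq_fun do rewrite mulmxBl mxE [X in _ + X]mxE.
  apply: finite_meanB; last exact: grad_cost_mean expectationsP p k.
  under eq_fun do rewrite mxE.
  apply: finite_mean_sum => t; apply: finite_meanZ.
  by under eq_fun do rewrite mxE; exact: grad_demand_mean expectationsP p k t.
rewrite dotDr -mean_dot; last exact: finite_mean_total_demand.
rewrite -mean_dot // -meanD; last 2 first.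
- by apply: finite_mean_dot; exact: finite_mean_total_demand.
- exact: finite_mean_dot.
congr mean; apply/funext => x.
have dwx : is_derive p v (fun q => q - wholesale mk x) v.
  by apply: is_derive_eq; rewrite subr0.
have dDx : is_derive p v (fun q => total_demand mk q x)
    ('D_v (fun q => total_demand mk q x) p).
  by apply: derivableP; exact: diff_derivable.
have dr := is_derive_dot _ _ _ _ _ _ _ _ dwx dDx.
rewrite -deriveE; last first.
  by apply: differentiable_dot => //; apply: differentiableB.
by rewrite (derive_val (is_derive := dr)) addrC dotC deriveEjacobian // dot_mulmx.
Qed.

Lemma continuous_phi : continuous (phi P mk).
Proof.
move=> p; apply: (@differentiable_continuous _ _ R^o).
exact: (revenue_exchange expectationsP p).1.
Qed.

(** The mean demand lost by the customers cancels the one gained by the retailer, leaving [g]. *)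
Lemma is_derive_total_surplus p v :
  is_derive p v (fun q => sw q : R^o) (dot v (g P mk p)).
Proof.
have dcs : is_derive p v (fun q => cs q : R^o) (dot v (- mean_demand p)).
  apply: is_derive_subgradient consumer_surplus_subgradient _.
  have -> : (fun q => dot v (- mean_demand q)) = - (fun q => dot v (mean_demand q)).
    by apply/funext => q; rewrite dotNr.
  by apply: (@continuousN _ R^o); exact: continuous_mean_demand.
have -> : (fun q => sw q : R^o) = (fun q => cs q : R^o) + (phi P mk : _ -> R^o).
  by apply/funext => q; rewrite total_surplus_linear.
have dphi := is_derive_phi p v.
by apply: is_derive_eq; rewrite -dotDr addKr.
Qed.

(** * Concavity from Assumption 1, and the optimal two-part price *)

Context (a1 : assumption1 P mk).

Lemma total_surplus_strict_supergradient p q :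
  q != p -> sw q < sw p + dot (q - p) (g P mk p).
Proof. exact: strict_tangent_inequality is_derive_total_surplus a1. Qed.

Lemma total_surplus_supergradient p q : sw q <= sw p + dot (q - p) (g P mk p).
Proof.
have [->|/total_surplus_strict_supergradient/ltW//] := eqVneq q p.
by rewrite subrr -(scale0r p) dotZl mul0r addr0.
Qed.

(** Subtract the lower tangent bound for consumer surplus from the upper one for total surplus. *)
Lemma phi_supergradient p q :
  phi P mk q <= phi P mk p + dot (q - p) (g P mk p + mean_demand p).
Proof.
have := total_surplus_supergradient p q; have := consumer_surplus_subgradient p q.
rewrite !total_surplus_linear dotDr dotNr; lra.
Qed.

(** A suitable fixed charge makes any price meet the target [F]; consumer surplus is then total
    surplus minus [F], so both have the same maximizers. *)
Lemma optimal_two_part_total_surplus A F p q : (0 < M)%N ->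
  optimal_tariff P mk (@two_part_tariffs R N) F (two_part_tariff A p) ->
  sw q <= sw p.
Proof.
move=> M0 [_ rsF opt].
have M0R : M%:R != 0 :> R by rewrite pnatr_eq0 -lt0n.
(* The revenue missing at price [q], shared equally among the customers. *)
pose B := (F - phi P mk q) / M%:R.
have BM : B *+ M = F - phi P mk q by rewrite -mulr_natr divfK.
have := opt (two_part_tariff B q).
rewrite retailer_surplus_two_part BM subrKC => /(_ _ erefl).
rewrite (consumer_surplus_two_part B q) (consumer_surplus_two_part A p) BM.
rewrite !total_surplus_linear.
move: rsF; rewrite retailer_surplus_two_part => rsF.
have Bq : two_part_tariffs (two_part_tariff B q) by exists B, q.
by move=> /(_ Bq); lra.
Qed.

End Market.

(** * Surpluses along the optimal linear tariffs *)

Theorem corollary3 (d : measure_display) (Omega : measurableType d)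
    (R : realType) (P : probability Omega R) (N M : nat)
    (mk : market Omega R N M)
    (Astar Fstar : R) (pistar piM : 'rV[R]_N) (pidag : R -> 'rV[R]_N) :
  (0 < N)%N -> (0 < M)%N ->
  primitives_ok mk -> demand_ok P mk -> expectations_ok P mk ->
  assumption1 P mk ->
  optimal_tariff P mk (@two_part_tariffs R N) Fstar
    (two_part_tariff Astar pistar) ->
  (forall p, phi P mk p <= phi P mk piM) ->
  let I := `[phi P mk pistar, phi P mk piM]%classic in
  (forall F, I F ->
     optimal_tariff P mk (@linear_tariffs R N) F (linear_tariff (pidag F))) ->
  demand_ge0_at mk pistar -> demand_ge0_at mk piM ->
  (forall F, I F -> demand_ge0_at mk (pidag F)) ->
  let swstar := total_surplus P mk (two_part_tariff Astar pistar) in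
  let swdag F := total_surplus P mk (linear_tariff (pidag F)) in
  let csdag F := consumer_surplus P mk (linear_tariff (pidag F)) in
  [/\ strictly_decreasing_on I swdag /\ concave_on I swdag,
      strictly_decreasing_on I csdag /\ concave_on I csdag,
      swdag (phi P mk pistar) = swstar
    & csdag (phi P mk pistar) = swstar - phi P mk pistar].
Proof.
move=> _ M_gt0 _ dP eP a1 opt2 phiM I opt1 _ _ _ swstar swdag csdag.
have sw_max p : total_surplus P mk (linear_tariff p) <=
    total_surplus P mk (linear_tariff pistar).
  exact: (optimal_two_part_total_surplus P mk dP eP _ _ _ _ M_gt0 opt2).
have sw_lt p : p != pistar -> total_surplus P mk (linear_tariff p) <
    total_surplus P mk (linear_tariff pistar).
  apply: strict_supergradient_max sw_max.
  exact: total_surplus_strict_supergradient.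
have I_ge F : I F -> phi P mk pistar <= F by rewrite /I /= in_itv /= => /andP[].
have phi_dag F : I F -> phi P mk (pidag F) = F.
  by move=> /opt1[_ + _]; rewrite retailer_surplus_linear.
(* On the level set [phi = F], total and consumer surplus differ by the constant [F]. *)
have sw_dag F q : I F -> phi P mk q = F ->
    total_surplus P mk (linear_tariff q) <= swdag F.
  move=> IF qF; have [_ _ /(_ (linear_tariff q))] := opt1 F IF.
  rewrite retailer_surplus_linear // => /(_ _ qF) cs_le.
  rewrite /swdag !total_surplus_linear // qF phi_dag // lerD2r.
  by apply: cs_le; exists q.
have csdagE F : I F -> csdag F = swdag F - F.
  by move=> IF; rewrite /swdag total_surplus_linear // phi_dag // addrK.
have sw_concave p q t := supergradient_concave _ _ p q t
  (total_surplus_supergradient P mk dP eP a1).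
have phi_concave p q t := supergradient_concave _ _ p q t
  (phi_supergradient P mk dP eP a1).
have decr y z : I y -> I z -> y < z -> swdag z < swdag y.
  exact: frontier_decreasing (continuous_phi P mk eP)
    sw_concave sw_lt I_ge phi_dag sw_dag y z.
have I_conv (t : {i01 R}) y z : I y -> I z ->
    I (t%:inum * y + (1 - t%:inum) * z).
  rewrite /I /= !in_itv /= => /andP[y0 y1] /andP[z0 z1].
  have t0 : 0 <= t%:inum by [].
  have t1 : t%:inum <= 1 :> R by [].
  by apply/andP; split; nra.
have conc (t : {i01 R}) y z : I y -> I z ->
    t%:inum * swdag y + (1 - t%:inum) * swdag z <=
    swdag (t%:inum * y + (1 - t%:inum) * z).
  move=> Iy Iz; apply: (frontier_concave _ _ _ _ _ (continuous_phi P mk eP)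
    phi_concave sw_concave sw_lt I_ge phi_dag sw_dag y z) => //.
  - by apply/andP.
  - exact: I_conv.
have I_star : I (phi P mk pistar) by rewrite /I /= in_itv /= lexx phiM.
(* At this target [pistar] itself competes among the linear tariffs, and no price beats it in total
   surplus. *)
have sw_star : swdag (phi P mk pistar) = swstar.
  apply/eqP; rewrite /swstar total_surplus_two_part // eq_le sw_max /=.
  exact: sw_dag.
split.
- split=> [y z|t y z]; first exact: decr.
  rewrite !inE => Iy Iz; rewrite !convRE /unstable.onem.
  rewrite -[leLHS]/(- swdag (t%:inum * y + (1 - t%:inum) * z)).
  by have := conc t y z Iy Iz; lra.
(* Subtracting the increasing affine function [F] preserves strict decrease and concavity. *)
- split=> [y z Iy Iz yz|t y z].
    by rewrite !csdagE //; have := decr _ _ Iy Iz yz; lra.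
  rewrite !inE => Iy Iz; rewrite !convRE /unstable.onem.
  rewrite -[leLHS]/(- csdag (t%:inum * y + (1 - t%:inum) * z)).
  rewrite !csdagE //; last exact: I_conv.
  by have := conc t y z Iy Iz; lra.
- exact: sw_star.
- by rewrite csdagE // sw_star.
Qed.
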